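(* Let $K$ be a non-Archimedean local field with normalized absolute value $|\cdot|_K$ and residue field of cardinality $q$, let $\alpha>0$, and let $a,f$ be continuous radial complex-valued functions on $K$ (i.e. $x\mapsto a(|x|_K)$, $x\mapsto f(|x|_K)$, with finite limits $a(0),f(0)$ as $x\to0$). Let $N\in\mathbb Z$ be such that $|q^{-\alpha}a(|x|_K)|x|_K^\alpha|<1$ for all $|x|_K\le q^N$, and let $B_N=\{x\in K:|x|_K\le q^N\}$. Put $c_\alpha=\frac{1-q^{-\alpha}}{1-q^{\alpha-1}}$ and, for $x\ne0$, $$k_\alpha(x,y)=\big[1+q^{-\alpha}a(|x|_K)|x|_K^\alpha\big]^{-1}c_\alpha a(|x|_K)\big(|x|_K^{\alpha-1}-|y|_K^{\alpha-1}\big)\quad(\alpha\ne1),$$ $$k_1(x,y)=\frac{1-q}{q\log q}\big[1+q^{-1}a(|x|_K)|x|_K\big]^{-1}a(|x|_K)\big(\log|x|_K-\log|y|_K\big),$$ for $|y|_K<|x|_K$, with $k_\alpha(0,y)=0$ and $k_\alpha(x,y)=0$ when $|y|_K\ge|x|_K$; and $F(|x|_K)=\big[1+q^{-\alpha}a(|x|_K)|x|_K^\alpha\big]^{-1}f(|x|_K)$. Then the integral equation $$v(|x|_K)+\int_{|y|_K<|x|_K}k_\alpha(x,y)\,v(|y|_K)\,dy=F(|x|_K),\qquad x\in B_N,$$ has a unique continuous solution on $B_N$.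
   Context: $K$ is a non-discrete totally disconnected locally compact field; $|\cdot|_K$ is normalized so that its nonzero values are $q^n$, $n\in\mathbb Z$, where $q$ is the cardinality of the residue field; $dy$ is the additive Haar measure with $\int_{|y|_K\le1}dy=1$. *)

(* Defs.v *)
From HB Require Import structures.
From mathcomp Require Import all_boot all_order all_algebra.
From mathcomp Require Import all_classical all_reals all_analysis.
From mathcomp Require Import complex.

Set Implicit Arguments.
Unset Strict Implicit.
Unset Printing Implicit Defensive.
Import Order.TTheory GRing.Theory Num.Theory.
Import numFieldNormedType.Exports.

Local Open Scope classical_set_scope.
Local Open Scope ring_scope.
Local Open Scope complex_scope.

(* Pointed copy of a field (pointed at 0), needed to build sigma-algebras. *)
Definition ptd (K : fieldType) : Type := K.
HB.instance Definition _ (K : fieldType) := Choice.copy (ptd K) K.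
HB.instance Definition _ (K : fieldType) := isPointed.Build (ptd K) (0 : K).

Definition closed_balls {R : realType} (K : fieldType) (abs : K -> R)
    : set (set (ptd K)) :=
  [set B | exists (x : K) (r : R), B = [set y | abs (y - x) <= r]].

(* K with the Borel sigma-algebra of the metric |x - y| (generated by the
   closed balls; these generate all open sets since K is separable). *)
Definition borelK {R : realType} (K : fieldType) (abs : K -> R) : Type :=
  g_sigma_algebraType (closed_balls abs).

Section LocalField.
Context {R : realType} (K : fieldType).

(* The residue field {|x| <= 1}/{|x| < 1} has exactly q elements:
   r i are representatives of the q distinct residue classes. *)
Definition residue_card (abs : K -> R) (q : nat) : Prop :=
  exists r : 'I_q -> K,
    [/\ forall i, abs (r i) <= 1,
        forall i j, i != j -> ~ (abs (r i - r j) < 1) &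
        forall x, abs x <= 1 -> exists i, abs (x - r i) < 1].

Definition abs_complete (abs : K -> R) : Prop :=
  forall u : nat -> K,
    (forall e : R, 0 < e -> exists M, forall m n, (M <= m)%N -> (M <= n)%N ->
        abs (u m - u n) < e) ->
    exists l, forall e : R, 0 < e -> exists M, forall n, (M <= n)%N ->
        abs (u n - l) < e.

(* K with abs is a non-Archimedean local field whose absolute value is
   normalized: the nonzero values are exactly the q^n, n in Z, q being the
   cardinality of the residue field.  (Standard characterization: complete
   for a discrete non-trivial non-Archimedean absolute value with finite
   residue field.) *)
Definition nonarch_local_field (abs : K -> R) (q : nat) : Prop :=
  (forall x, abs x = 0 <-> x = 0) /\
  (forall x y, abs (x * y) = abs x * abs y) /\
  (forall x y, abs (x + y) <= Num.max (abs x) (abs y)) /\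
  (forall x, x != 0 -> exists n : int, abs x = (q%:R : R) ^ n) /\
  (forall n : int, exists x, abs x = (q%:R : R) ^ n) /\
  residue_card abs q /\
  abs_complete abs.

Definition normalized_haar (abs : K -> R)
    (mu : {measure set (borelK abs) -> \bar R}) : Prop :=
  (forall (A : set (borelK abs)) (a : K), measurable A ->
     mu [set (a + y : K) | y in A] = mu A) /\
  mu [set y | abs y <= 1] = 1%E.

Definition radial_continuous_on (abs : K -> R) (g : R -> R[i]) (S : set K) : Prop :=
  forall x, S x -> forall e : R, 0 < e ->
    exists2 del : R, 0 < del &
      forall y, S y -> abs (y - x) < del -> Normc.normc (g (abs y) - g (abs x)) < e.

Definition cintegrable (abs : K -> R) (mu : {measure set (borelK abs) -> \bar R}) (D : set (borelK abs))
    (g : borelK abs -> R[i]) : Prop :=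
  mu.-integrable D (fun y => (complex.Re (g y))%:E) /\
  mu.-integrable D (fun y => (complex.Im (g y))%:E).

Definition cintegral (abs : K -> R) (mu : {measure set (borelK abs) -> \bar R}) (D : set (borelK abs))
    (g : borelK abs -> R[i]) : R[i] :=
  Complex (Rintegral mu D (fun y => complex.Re (g y)))
          (Rintegral mu D (fun y => complex.Im (g y))).

Definition c_alpha (q : nat) (alpha : R) : R :=
  (1 - (q%:R : R) `^ (- alpha)) / (1 - (q%:R : R) `^ (alpha - 1)).

Definition denom_inv (q : nat) (alpha : R) (a : R -> R[i]) (r : R) : R[i] :=
  (1 + ((q%:R : R) `^ (- alpha))%:C * a r * (r `^ alpha)%:C)^-1.

Definition k_alpha (abs : K -> R) (q : nat) (alpha : R) (a : R -> R[i])
    (x y : K) : R[i] :=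
  if (x == 0) || (abs x <= abs y) then 0
  else if alpha == 1 then
    ((1 - (q%:R : R)) / ((q%:R : R) * ln (q%:R : R)))%:C
      * denom_inv q 1 a (abs x) * a (abs x)
      * (ln (abs x) - ln (abs y))%:C
  else
    denom_inv q alpha a (abs x) * (c_alpha q alpha)%:C * a (abs x)
      * (abs x `^ (alpha - 1) - abs y `^ (alpha - 1))%:C.

Definition F_rhs (q : nat) (alpha : R) (a f : R -> R[i]) (r : R) : R[i] :=
  denom_inv q alpha a r * f r.

Definition ballN (abs : K -> R) (q : nat) (N : int) : set K :=
  [set x | abs x <= (q%:R : R) ^ N].

Definition is_solution (abs : K -> R) (q : nat)
    (mu : {measure set (borelK abs) -> \bar R})
    (alpha : R) (a f : R -> R[i]) (N : int) (v : R -> R[i]) : Prop :=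
  radial_continuous_on abs v (ballN abs q N) /\
  forall x, ballN abs q N x ->
    cintegrable mu [set y | abs y < abs x]
      (fun y => k_alpha abs q alpha a x y * v (abs y)) /\
    v (abs x) + cintegral mu [set y | abs y < abs x]
      (fun y => k_alpha abs q alpha a x y * v (abs y))
    = F_rhs q alpha a f (abs x).

End LocalField.

Arguments normalized_haar {R K} abs mu.
Arguments cintegrable {R K} abs mu D g.
Arguments cintegral {R K} abs mu D g.
Arguments is_solution {R K} abs q mu alpha a f N v.

(* Main.v *)
(* Only the values v_n = v(q^n) and v(0) matter, and since the ball of radius
   q^n has Haar measure q^n, integrals of radial functions are sums over the
   spheres |y| = q^j.  The kernel satisfies
     |k(x,y)| <= C(x) |x|^(alpha-e) |y|^(e-1)   with e = min(alpha, 1/2),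
   so the integral operator maps functions bounded by B to functions bounded by
   C' C(x) |x|^alpha B, with C(x) bounded near 0.  On a small ball the operator
   is therefore a contraction, which gives a unique bounded solution there, by
   Picard iteration; the same bound gives its continuity at 0.  From one sphere
   to the next the equation is explicit, because the integral only involves
   |y| < |x|, so the solution extends uniquely to B_N. *)
Require Import Defs.
From HB Require Import structures.
From mathcomp Require Import all_boot all_order all_algebra.
From mathcomp Require Import all_classical all_reals all_analysis.
From mathcomp Require Import complex ring lra zify measurable_realfun.
Import Order.TTheory GRing.Theory Num.Theory.
Import numFieldNormedType.Exports.
Local Open Scope classical_set_scope.
Local Open Scope ring_scope.
Local Open Scope complex_scope.

(** * Non-Archimedean absolute value *)

Section AbsoluteValue.
Context {R : realType} {K : fieldType} {abs : K -> R} {q : nat}.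
Hypothesis lf : nonarch_local_field abs q.

Lemma abs_eq0 x : abs x = 0 <-> x = 0.
Proof. by case: lf. Qed.

Lemma abs0 : abs 0 = 0.
Proof. exact/abs_eq0. Qed.

Lemma absM x y : abs (x * y) = abs x * abs y.
Proof. by case: lf => _ []. Qed.

Lemma abs_ultra x y : abs (x + y) <= Num.max (abs x) (abs y).
Proof. by case: lf => _ [_ []]. Qed.

Lemma abs_values x : x != 0 -> exists n : int, abs x = (q%:R : R) ^ n.
Proof. by case: lf => _ [_ [_ [+ _]]]; apply. Qed.

Lemma abs_onto (n : int) : exists x, abs x = (q%:R : R) ^ n.
Proof. by case: lf => _ [_ [_ [_ [+ _]]]]; apply. Qed.

Lemma abs_residue : residue_card abs q.
Proof. by case: lf => _ [_ [_ [_ [_ []]]]]. Qed.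

Lemma abs1 : abs 1 = 1.
Proof.
have n0 : abs 1 != 0 by apply/eqP => /abs_eq0/eqP; rewrite oner_eq0.
by apply: (mulfI n0); rewrite -absM !mulr1.
Qed.

Lemma abs_ge0 x : 0 <= abs x.
Proof.
have [->|/abs_values[n ->]] := eqVneq x 0; first by rewrite abs0.
exact/exprz_ge0/ler0n.
Qed.

Lemma absN x : abs (- x) = abs x.
Proof.
have h : abs (-1) ^+ 2 = 1 by rewrite expr2 -absM mulrNN mulr1 abs1.
rewrite -mulN1r absM; move/eqP: h; rewrite sqrf_eq1 => /orP[/eqP->|/eqP h].
  by rewrite mul1r.
by have := abs_ge0 (-1); rewrite h; lra.
Qed.

(** The residue classes of 0 and 1 differ: a common representative would force |1| < 1 by the
    ultrametric inequality. *)
Lemma card_gt1 : (1 < q)%N.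
Proof.
have [r [_ _ r3]] := abs_residue.
have [i hi] : exists i, abs (0 - r i) < 1 by apply: r3; rewrite abs0.
have [j hj] : exists i, abs (1 - r i) < 1 by apply: r3; rewrite abs1.
rewrite ltnNge; apply/negP => q1.
have ij : i = j by apply/val_inj; move: (ltn_ord i) (ltn_ord j) q1 => /=; lia.
rewrite {}ij in hi.
have := abs_ultra (1 - r j) (- (0 - r j)).
rewrite absN (_ : _ - _ = 1); last by ring.
by rewrite abs1 leNgt gt_max hi hj.
Qed.

Local Notation Q := (q%:R : R).

Lemma q_gt1 : 1 < Q.
Proof. by rewrite ltr1n card_gt1. Qed.

Lemma q_gt0 : 0 < Q.
Proof. exact: lt_trans ltr01 q_gt1. Qed.

Lemma q_neq0 : Q != 0.
Proof. by rewrite gt_eqF// q_gt0. Qed.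

Lemma qX_gt0 (n : int) : 0 < Q ^ n.
Proof. exact/exprz_gt0/q_gt0. Qed.

Lemma qX_inj (m n : int) : Q ^ m = Q ^ n -> m = n.
Proof. by move=> h; apply/le_anti; rewrite -!(ler_eXz2l q_gt1) h lexx. Qed.

Lemma abs_gt0 x : x != 0 -> 0 < abs x.
Proof. by move=> /abs_values[n ->]; exact: qX_gt0. Qed.

Lemma abs_eq0E x : (abs x == 0) = (x == 0).
Proof. by apply/eqP/eqP => /abs_eq0. Qed.

Lemma abs_subC x y : abs (x - y) = abs (y - x).
Proof. by rewrite -opprB absN. Qed.

(** The value group is discrete, with no value strictly between q^(n-1) and q^n. This turns open
    balls into closed ones. *)
Lemma abs_lt_qX x (n : int) : (abs x < Q ^ n) = (abs x <= Q ^ (n - 1)).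
Proof.
have [->|/abs_values[m ->]] := eqVneq x 0.
  by rewrite abs0 qX_gt0 ltW ?qX_gt0.
by rewrite ltr_eXz2l ?q_gt1// ler_eXz2l ?q_gt1//; lia.
Qed.

(** The ultrametric isosceles principle, from which [abs] is locally constant off the origin. *)
Lemma abs_eq_near x y : abs (y - x) < abs x -> abs y = abs x.
Proof.
move=> h; apply/eqP; rewrite eq_le; apply/andP; split.
  by have := abs_ultra (y - x) x; rewrite subrK (max_idPr (ltW h)).
rewrite leNgt; apply/negP => h2.
have := abs_ultra (x - y) y; rewrite subrK leNgt gt_max h2 andbT.
by rewrite abs_subC h.
Qed.

Lemma qX_small (e : R) : 0 < e -> exists M : int, Q ^ M < e.
Proof.
move=> e0.
have Qi : `|Q^-1| < 1.
  by rewrite ger0_norm ?invr_ge0 ?(ltW q_gt0)// invf_lt1 ?q_gt0 ?q_gt1.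
have /cvgrPdist_lt/(_ e e0)[k _ /(_ k (leqnn k))] := @cvg_geometric R 1 _ Qi.
rewrite /= mul1r sub0r normrN ger0_norm ?exprn_ge0 ?invr_ge0 ?(ltW q_gt0)// => h.
by exists (- (k%:Z)); rewrite -exprz_inv.
Qed.

(* Away from the origin [abs] is locally constant, so continuity of a radial
   function is only an issue at 0. *)
Lemma radial_continuous_onP (g : R -> R[i]) (S : set K) : S 0 ->
  radial_continuous_on abs g S <->
  (forall e : R, 0 < e -> exists M : int, forall y, S y -> abs y <= Q ^ M ->
     Normc.normc (g (abs y) - g 0) < e).
Proof.
move=> S0; split=> [h e e0|h x Sx e e0].
  have [d d0 hd] := h _ S0 e e0; have [M HM] := qX_small _ d0.
  exists M => y Sy yM; have := hd y Sy; rewrite subr0 abs0; apply.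
  exact: le_lt_trans HM.
have [->|x0] := eqVneq x 0.
  have [M HM] := h e e0; exists (Q ^ M); first exact: qX_gt0.
  by move=> y Sy; rewrite subr0 abs0 => /ltW; exact: HM.
exists (abs x); first exact: abs_gt0.
by move=> y Sy /abs_eq_near ->; rewrite subrr Normc.normc0.
Qed.

End AbsoluteValue.

(** * Haar measure of balls and spheres *)

Section Haar.
Context {R : realType} {K : fieldType} {abs : K -> R} {q : nat}.
Context {mu : {measure set (borelK abs) -> \bar R}}.
Hypothesis lf : nonarch_local_field abs q.
Local Notation Q := (q%:R : R).

Lemma measurable_closed_ball (a : K) (r : R) :
  measurable ([set y : K | abs (y - a) <= r] : set (borelK abs)).
Proof. by apply: sub_gen_smallest; exists a, r. Qed.

Lemma measurable_sphere (n : int) :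
  measurable ([set y : K | abs y = Q ^ n] : set (borelK abs)).
Proof.
rewrite (_ : mkset _ = [set y : K | abs (y - 0) <= Q ^ n] `\`
    [set y : K | abs (y - 0) <= Q ^ (n - 1)] :> set (borelK abs)).
  by apply: measurableD; exact: measurable_closed_ball.
apply/seteqP; split => y /=; rewrite subr0 -(abs_lt_qX lf).
  by move=> ->; rewrite lexx ltxx.
by case=> h /negP; rewrite -leNgt => h2; apply/le_anti; rewrite h h2.
Qed.

Lemma measurable_0 : measurable ([set 0 : K] : set (borelK abs)).
Proof.
rewrite (_ : [set 0] = [set y : K | abs (y - 0) <= 0] :> set (borelK abs)).
  exact: measurable_closed_ball.
apply/seteqP; split => y /=; rewrite subr0; first by move=> ->; rewrite (abs0 lf).
by move=> h; apply/(abs_eq0 lf)/le_anti; rewrite h (abs_ge0 lf).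
Qed.

(* A radial set is a countable union of spheres, up to the origin. *)
Lemma measurable_radial (P : R -> Prop) :
  measurable ([set y : K | P (abs y)] : set (borelK abs)).
Proof.
rewrite (_ : mkset _ = ([set 0 : K] `&` [set y | P (abs y)]) `|`
   \bigcup_(n : int) ([set y : K | abs y = Q ^ n] `&` [set y : K | P (abs y)])
   :> set (borelK abs)).
  apply: measurableU.
    have [p|np] := pselect (P 0).
      rewrite setIidl; first exact: measurable_0.
      by move=> y /= ->; rewrite (abs0 lf).
    rewrite (_ : _ `&` _ = set0) //.
    by rewrite -subset0 => y [/= ->]; rewrite (abs0 lf).
  apply: countable_bigcupT_measurable => [//|n].
  have [p|np] := pselect (P (Q ^ n)).
    rewrite setIidl; first exact: measurable_sphere.
    by move=> y /= ->.
  rewrite (_ : _ `&` _ = set0) //.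
  by rewrite -subset0 => y [/= ->].
apply/seteqP; split => y /=.
  have [->|/(abs_values lf)[n yn]] := eqVneq y 0; first by left.
  by right; exists n.
by move=> [[]|[n _ []]].
Qed.

Lemma measurable_fun_radial d (T : sigmaRingType d) (D : set (borelK abs)) (g : R -> T) :
  measurable_fun D (fun y : borelK abs => g (abs y)).
Proof.
move=> mD Y mY; apply: measurableI => //.
exact: (measurable_radial (fun r => Y (g r))).
Qed.

Hypothesis haar : normalized_haar abs mu.

Lemma haar_closed_ball (a : K) (r : R) :
  mu [set y : K | abs (y - a) <= r] = mu [set y : K | abs y <= r].
Proof.
case: haar => + _ => /(_ [set y : K | abs y <= r] a
  (measurable_radial (fun s => s <= r))) <-.
congr (mu _); apply/seteqP; split => y /=.
  by move=> h; exists (y - a) => //; rewrite addrC subrK.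
by move=> [z h <-]; rewrite addrC addKr.
Qed.

(** Scaling the residue classes by some [p] with |p| = q^(n+1) splits the larger ball into q
    disjoint translates of the smaller one, all of equal measure by invariance. *)
Lemma haar_ball_succ (n : int) :
  mu [set y : K | abs y <= Q ^ (n + 1)] =
  (q%:R%:E * mu [set y : K | (abs y <= Q ^ n)%R])%E.
Proof.
have [p pn] := abs_onto lf (n + 1).
have p0 : p != 0 by rewrite -(abs_eq0E lf) pn gt_eqF ?(qX_gt0 lf).
have [r [r1 r2 r3]] := abs_residue lf.
(* [B i] consists of the y for which y / p lies in the residue class of [r i]; this is what [hB]
   says. *)
pose B (i : 'I_q) : set (borelK abs) := [set y : K | abs (y - p * r i) <= Q ^ n].
have hB (i : 'I_q) (y : K) : B i y <-> abs (y / p - r i) < 1.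
  rewrite /B /=.
  have -> : y - p * r i = p * (y / p - r i) by rewrite mulrBr mulrCA mulfV// mulr1.
  rewrite -[n in X in X <-> _](addrK 1) -(abs_lt_qX lf) -pn (absM lf).
  by rewrite gtr_pMr ?pn ?(qX_gt0 lf).
rewrite (_ : mkset _ = \big[setU/set0]_(i < q) B i :> set (borelK abs)); last first.
  rewrite -(bigcup_seq (index_enum 'I_q)); apply/seteqP; split => y /=.
    move=> hy; have [|i hi] := r3 (y / p).
      have : abs (y / p) * abs p <= 1 * abs p.
        by rewrite -(absM lf) mulfVK// mul1r pn.
      by rewrite ler_pM2r// pn (qX_gt0 lf).
    by exists i; [rewrite /= mem_index_enum|exact/hB].
  move=> [i _ /hB h]; have : abs (y / p) <= 1.
    rewrite -(subrK (r i) (y / p)); apply: le_trans (abs_ultra lf _ _) _.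
    by rewrite ge_max ltW//= r1.
  move=> h1; have : abs (y / p) * abs p <= 1 * abs p.
    by rewrite ler_pM2r// pn (qX_gt0 lf).
  by rewrite -(absM lf) mulfVK// mul1r pn.
rewrite measure_bigsetU_ord; last 2 first.
- by move=> i; exact: measurable_closed_ball.
(* A common point would put [r i] and [r j] into the same residue class. *)
- move=> i j _ _ [y [/hB yi /hB yj]]; apply/eqP/negPn/negP => /r2; apply.
  rewrite -(subrKA (y / p)) addrC.
  apply: le_lt_trans (abs_ultra lf _ _) _.
  by rewrite gt_max yj (abs_subC lf) yi.
rewrite (eq_bigr (fun=> mu [set y : K | (abs y <= Q ^ n)%R])) => [|i _]; last first.
  exact: haar_closed_ball.
rewrite big_const cardT size_enum_ord mule_natl.
move: (mu _) => x; elim: q => [//|[|k] IH]; rewrite iterS IH ?adde0//.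

Qed.

(** The normalization gives n = 0, and [haar_ball_succ] propagates the value in both directions. *)
Lemma haar_ball (n : int) : mu [set y : K | abs y <= Q ^ n] = (Q ^ n)%:E.
Proof.
have h0 : mu [set y : K | abs y <= Q ^ 0] = (Q ^ 0)%:E by case: haar.
have up (m : int) : mu [set y : K | abs y <= Q ^ m] = (Q ^ m)%:E ->
    mu [set y : K | abs y <= Q ^ (m + 1)] = (Q ^ (m + 1))%:E.
  by rewrite haar_ball_succ => ->; rewrite -EFinM mulrC expfzDr ?(q_neq0 lf).
have dn (m : int) : mu [set y : K | abs y <= Q ^ (m + 1)] = (Q ^ (m + 1))%:E ->
    mu [set y : K | abs y <= Q ^ m] = (Q ^ m)%:E.
  rewrite haar_ball_succ expfzDr ?(q_neq0 lf)// expr1z mulrC.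
  (* Going down divides by q in the extended reals; infinite values are excluded because q times
     them would be infinite. *)
  case: (mu _) => [s| |].
  - by rewrite -EFinM => -[] /(mulfI (q_neq0 lf)) ->.
  - by rewrite gt0_muley ?lte_fin ?(q_gt0 lf).
  - by rewrite gt0_muleNy ?lte_fin ?(q_gt0 lf).
elim/int_ind: n => [//|n IH|n IH].
  by rewrite -addn1 PoszD; exact: up.
by apply: dn; rewrite -[n.+1]addn1 PoszD opprD addrNK.
Qed.

Lemma haar_0 : mu [set 0 : K] = 0%E.
Proof.
apply/le_anti; rewrite measure_ge0 andbT; apply/lee_addgt0Pr => e e0.
rewrite add0e; have [M /ltW HM] := qX_small lf _ e0.
apply: (@le_trans _ _ (mu [set y : K | abs y <= Q ^ M])).
  apply: le_measure; rewrite ?inE.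
  - exact: measurable_0.
  - exact: (measurable_radial (fun s => s <= Q ^ M)).
  - by move=> y /= ->; rewrite (abs0 lf) ltW ?(qX_gt0 lf).
by rewrite haar_ball lee_fin.
Qed.

Lemma haar_sphere_le (n : int) :
  (mu [set y : K | abs y = (Q ^ n)%R] <= (Q ^ n)%:E)%E.
Proof.
rewrite -haar_ball; apply: le_measure; rewrite ?inE.
- exact: measurable_sphere.
- exact: (measurable_radial (fun s => s <= Q ^ n)).
- by move=> y /= ->.
Qed.

End Haar.

(** * Integrals of radial functions over open balls *)

Section RadialIntegral.
Context {R : realType} {K : fieldType} {abs : K -> R} {q : nat}.
Context {mu : {measure set (borelK abs) -> \bar R}}.
Hypothesis lf : nonarch_local_field abs q.
Hypothesis haar : normalized_haar abs mu.
Local Notation Q := (q%:R : R).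
Local Notation D x := [set y : borelK abs | abs y < abs x].

Lemma measurable_open_ball (x : K) : measurable (D x).
Proof. exact: (measurable_radial lf (fun s => s < abs x)). Qed.

Lemma powR_qN_lt1 (e : R) : 0 < e -> Q `^ (- e) < 1.
Proof.
move=> e0; rewrite powRN invf_lt1 ?powR_gt0 ?(q_gt0 lf)//.
rewrite -[X in X < _](congr1 (@^~ e) (powR1 R)).
by rewrite gt0_ltr_powR ?nnegrE ?(q_gt1 lf)// ltW ?(q_gt0 lf).
Qed.

(** The integrand is constant on the sphere, whose measure is at most q^j; that factor raises the
    exponent from e - 1 to e. *)
Lemma integral_sphere_le (g : R -> R) (c e : R) (j : int) : 0 <= c -> 0 < e ->
  `|g (Q ^ j)| <= c * (Q ^ j) `^ (e - 1) ->
  (\int[mu]_(y in [set y : borelK abs | abs y = (Q ^ j)%R]) `|g (abs y)|%:E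
     <= (c * (Q ^ j) `^ e)%:E)%E.
Proof.
move=> c0 e0 hg; have mS : measurable [set y : borelK abs | abs y = Q ^ j].
  exact: (measurable_sphere lf).
rewrite (eq_integral (cst `|g (Q ^ j)|%:E)) => [|y /[!inE] /= -> //].
rewrite integral_cst//.
apply: (@le_trans _ _ ((c * (Q ^ j) `^ (e - 1))%:E * (Q ^ j)%:E)%E).
  by apply: lee_pmul; rewrite ?lee_fin//; exact: (haar_sphere_le lf haar).
by rewrite -EFinM lee_fin -mulrA [_ * Q ^ j]mulrC mulr_powRB1 // ltW ?(qX_gt0 lf).
Qed.

Lemma powR_qXB (e : R) (n : int) (k : nat) :
  (Q ^ (n - k%:Z)) `^ e = (Q ^ n) `^ e * (Q `^ (- e)) ^+ k.
Proof.
have Q0 := ltW (q_gt0 lf).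
rewrite expfzDr ?(q_neq0 lf)// powRM ?ltW ?(qX_gt0 lf)//; congr (_ * _).
by rewrite -powR_intmul// -powRrM -powR_mulrn ?powR_ge0// -powRrM mulrNz mulNr -mulrN mulrC.
Qed.

(** The ball is cut into spheres, whose contributions are dominated by a geometric series of ratio
    q^(-e); its sum produces the denominator. *)
Lemma integral_radial_le (g : R -> R) (c e : R) (x : K) : 0 <= c -> 0 < e ->
  (forall y, y != 0 -> abs y < abs x -> `|g (abs y)| <= c * (abs y) `^ (e - 1)) ->
  (\int[mu]_(y in D x) `|g (abs y)|%:E
     <= (c * (abs x) `^ e / (1 - Q `^ (- e)))%:E)%E.
Proof.
move=> c0 e0 hg; have Qe := powR_qN_lt1 _ e0; have Q0 := ltW (q_gt0 lf).
have [x0|x0] := eqVneq x 0.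
  rewrite (_ : D x = set0) ?integral_set0.
    by rewrite lee_fin divr_ge0 ?mulr_ge0 ?powR_ge0// subr_ge0 ltW.
  by rewrite -subset0 => y /=; rewrite x0 (abs0 lf) ltNge (abs_ge0 lf).
have [n xn] := abs_values lf _ x0.
(* The outermost sphere has radius q^(n-1), because |y| < |x| = q^n is strict. *)
pose S k : set (borelK abs) := [set y | abs y = Q ^ (n - 1 - k%:Z)].
have mS k : measurable (S k) by exact: (measurable_sphere lf).
have m0 : measurable ([set 0 : K] : set (borelK abs)) by exact: (measurable_0 lf).
(* The origin is a null set; removing it leaves only points that lie on spheres and satisfy the
   bound on [g]. *)
rewrite (ge0_negligible_integral m0 (measurable_open_ball x)); last 3 first.
- exact: (measurable_fun_radial lf _ _ _ (fun s => `|g s|%:E)).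
- by move=> y _; rewrite lee_fin.
- exact: (haar_0 lf haar).
have -> : D x `\` [set 0 : K] = \bigcup_k S k.
  apply/seteqP; split => y /=.
    rewrite xn (abs_lt_qX lf) => -[+ /eqP y0]; have [m ym] := abs_values lf _ y0.
    rewrite ym ler_eXz2l ?(q_gt1 lf)// => mn.
    by exists (absz (n - 1 - m)%R) => //; rewrite /S /= ym; congr (_ ^ _); lia.
  move=> [k _ yk]; rewrite xn (abs_lt_qX lf) yk ler_eXz2l ?(q_gt1 lf)//; split; first lia.
  by move=> y0; have := qX_gt0 lf (n - 1 - k%:Z); rewrite -yk y0 (abs0 lf) ltxx.
rewrite ge0_integral_bigcup//; last 2 first.
- exact: (measurable_fun_radial lf _ _ _ (fun s => `|g s|%:E)).
- by move=> i j _ _ [y []]; rewrite /S /= => -> /(qX_inj lf); lia.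
apply: lime_le; first by apply: is_cvg_nneseries => k _ _; apply: integral_ge0.
apply: nearW => m.
(* [a] bounds the contribution of the outermost sphere; by [powR_qXB] each further sphere inward
   gains a factor q^(-e). *)
pose a := c * (Q ^ (n - 1)) `^ e.
apply: (@le_trans _ _ (\sum_(0 <= k < m) (geometric a (Q `^ (- e)) k)%:E)).
  apply: lee_sum => k _; rewrite /= /a -mulrA -powR_qXB; apply: integral_sphere_le => //.
  have [y yk] := abs_onto lf (n - 1 - k%:Z); rewrite -yk; apply: hg.
    by rewrite -(abs_eq0E lf) yk gt_eqF ?(qX_gt0 lf).
  by rewrite xn (abs_lt_qX lf) yk ler_eXz2l ?(q_gt1 lf)//; lia.
rewrite sumEFin lee_fin; apply: (@le_trans _ _ (a / (1 - Q `^ (- e)))).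
  apply: geometric_le_lim; rewrite ?powR_gt0 ?(q_gt0 lf)//.
    by rewrite mulr_ge0 ?powR_ge0.
  by rewrite ger0_norm ?powR_ge0.
rewrite ler_pM2r ?invr_gt0 ?subr_gt0// xn ler_wpM2l//.
apply: ge0_ler_powR; rewrite ?nnegrE ?(ltW e0) ?ltW ?(qX_gt0 lf)//.
by rewrite ltr_eXz2l ?(q_gt1 lf)//; lia.
Qed.

Lemma radial_integral (g : R -> R) (c e : R) (x : K) : 0 <= c -> 0 < e ->
  (forall y, y != 0 -> abs y < abs x -> `|g (abs y)| <= c * (abs y) `^ (e - 1)) ->
  mu.-integrable (D x) (fun y => (g (abs y))%:E) /\
  `|Rintegral mu (D x) (fun y => g (abs y))| <= c * (abs x) `^ e / (1 - Q `^ (- e)).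
Proof.
move=> c0 e0 hg; have h := integral_radial_le _ _ _ _ c0 e0 hg.
have ig : mu.-integrable (D x) (fun y => (g (abs y))%:E).
  apply/integrableP; split.
    exact: (measurable_fun_radial lf _ _ _ (fun s => (g s)%:E)).
  by apply: le_lt_trans h _; rewrite ltry.
split=> //; apply: le_trans (le_normr_Rintegral (measurable_open_ball x) ig) _.
rewrite -lee_fin; apply: le_trans h; rewrite /Rintegral fineK//.
apply: integrable_fin_num => //; first exact: measurable_open_ball.
exact: (integrable_abse ig).
Qed.

End RadialIntegral.

(** * The integral operator *)

Section ComplexModulus.
Context {R : realType}.
Implicit Types (z w : R[i]).
Local Notation normc := (@Normc.normc R).

Lemma normc_ge0 z : 0 <= normc z.
Proof. by case: z => x y; exact: sqrtr_ge0. Qed.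

Lemma normc_real (x : R) : normc x%:C = `|x|.
Proof. by rewrite /Normc.normc /= expr0n addr0 sqrtr_sqr. Qed.

Lemma normcD_le z w : normc (z + w) <= normc z + normc w.
Proof. exact: le_normcD. Qed.

Lemma normcB_le z w : normc (z - w) <= normc z + normc w.
Proof. by rewrite -(normcN w); exact: normcD_le. Qed.

Lemma normc_le_add (x y : R) : normc (x +i* y) <= `|x| + `|y|.
Proof.
rewrite /= -[leRHS]ger0_norm ?addr_ge0// -sqrtr_sqr ler_sqrt ?sqr_ge0//.
by rewrite sqrrD !real_normK ?num_real// addrAC lerDl mulrn_wge0// mulr_ge0.
Qed.

Lemma Re_le_normc z : `|complex.Re z| <= normc z.
Proof.
by case: z => x y; rewrite /= -sqrtr_sqr ler_sqrt ?addr_ge0 ?sqr_ge0// lerDl sqr_ge0.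
Qed.

Lemma Im_le_normc z : `|complex.Im z| <= normc z.
Proof.
by case: z => x y; rewrite /= -sqrtr_sqr ler_sqrt ?addr_ge0 ?sqr_ge0// lerDr sqr_ge0.
Qed.

Lemma ReB z w : complex.Re (z - w) = complex.Re z - complex.Re w.
Proof. by case: z w => [? ?] [? ?]. Qed.

Lemma ImB z w : complex.Im (z - w) = complex.Im z - complex.Im w.
Proof. by case: z w => [? ?] [? ?]. Qed.

End ComplexModulus.

(** The kernel [k_alpha] seen as a function of r = |x| and s = |y| alone, so that the equation
    becomes one for functions of a real radius. *)
Definition radial_kernel {R : realType} (q : nat) (alpha : R) (a : R -> R[i])
    (r s : R) : R[i] :=
  if (r == 0) || (r <= s) then 0
  else if alpha == 1 then
    ((1 - (q%:R : R)) / ((q%:R : R) * ln (q%:R : R)))%:C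
      * denom_inv q 1 a r * a r * (ln r - ln s)%:C
  else
    denom_inv q alpha a r * (c_alpha q alpha)%:C * a r
      * (r `^ (alpha - 1) - s `^ (alpha - 1))%:C.

(** * Pointwise bounds for the kernel *)

Section KernelBound.
Context {R : realType} {alpha e : R}.
Hypotheses (e0 : 0 < e) (e_alpha : e <= alpha) (e_half : e <= 2^-1).

(** Both powers are nonnegative, so it is enough to bound each. Splitting alpha - 1 as (alpha - e) +
    (e - 1), the first uses that t^(e-1) decreases in t, the second that t^(alpha-e) does not
    decrease. *)
Lemma powR_kernel_le (r s : R) : 0 < s -> s < r ->
  `|r `^ (alpha - 1) - s `^ (alpha - 1)| <= r `^ (alpha - e) * s `^ (e - 1).
Proof.
move=> s0 sr; have r0 := lt_trans s0 sr.
have hr : r `^ (alpha - 1) <= r `^ (alpha - e) * s `^ (e - 1).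
  rewrite (_ : alpha - 1 = (alpha - e) + (e - 1)); last by ring.
  rewrite (@powRD _ r (alpha - e) (e - 1)) ?(gt_eqF r0) ?implybT// ler_wpM2l ?powR_ge0//.
  rewrite -[e - 1]opprB !powRN lef_pV2 ?posrE ?powR_gt0//.
  by apply: ge0_ler_powR; rewrite ?nnegrE; move: e0 e_alpha e_half s0 sr r0; lra.
have hs : s `^ (alpha - 1) <= r `^ (alpha - e) * s `^ (e - 1).
  rewrite (_ : alpha - 1 = (alpha - e) + (e - 1)); last by ring.
  rewrite (@powRD _ s (alpha - e) (e - 1)) ?(gt_eqF s0) ?implybT// ler_wpM2r ?powR_ge0//.
  by apply: ge0_ler_powR; rewrite ?nnegrE; move: e0 e_alpha e_half s0 sr r0; lra.
have := powR_ge0 r (alpha - 1); have := powR_ge0 s (alpha - 1).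
by rewrite ler_norml; lra.
Qed.

(* [ln t <= t `^ (1 - e) / (1 - e)] at [t = r / s] *)
Lemma ln_kernel_le (r s : R) : 0 < s -> s < r ->
  `|ln r - ln s| <= 2 * (r `^ (1 - e) * s `^ (e - 1)).
Proof.
move=> s0 sr; have r0 := lt_trans s0 sr.
rewrite -ln_div ?posrE//.
have t1 : 1 < r / s by rewrite ltr_pdivlMr// mul1r.
have t0 : 0 < r / s by rewrite divr_gt0.
rewrite ger0_norm ?ln_ge0 ?ltW//.
have -> : r `^ (1 - e) * s `^ (e - 1) = (r / s) `^ (1 - e).
  rewrite powRM ?invr_ge0 ?ltW//; congr (_ * _).
  by rewrite -[s^-1]powR_inv1 ?ltW// -powRrM mulN1r opprB.
have := ln_sublinear (powR_gt0 (1 - e) t0); rewrite ln_powR.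
(* The factor 2 of the bound comes from 1 - e >= 1/2. *)
have : 2^-1 * ln (r / s) <= (1 - e) * ln (r / s).
  by apply: ler_wpM2r; [exact/ln_ge0/ltW|move: e_half; lra].
lra.
Qed.

Lemma radial_kernel_bound (q : nat) (a : R -> R[i]) :
  exists2 C : R, 0 <= C & forall r s : R, 0 < s -> s < r ->
    Normc.normc (radial_kernel q alpha a r s) <=
    C * Normc.normc (denom_inv q alpha a r * a r) * (r `^ (alpha - e) * s `^ (e - 1)).
Proof.
pose A : R := `|(1 - (q%:R : R)) / ((q%:R : R) * ln (q%:R : R))|.
pose c : R := `|c_alpha q alpha|.
have A0 : 0 <= A by exact: normr_ge0.
have c0 : 0 <= c by exact: normr_ge0.
(* One constant serves both forms of the kernel: [2 * A] for the logarithm at alpha = 1, [c] for the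
   powers otherwise. *)
exists (2 * A + c); first by rewrite addr_ge0 ?mulr_ge0.
move=> r s s0 sr; have r0 := lt_trans s0 sr.
rewrite /radial_kernel (gt_eqF r0) (leNgt r s) sr /=.
pose k : R := r `^ (alpha - e) * s `^ (e - 1).
have k0 : 0 <= k by rewrite mulr_ge0 ?powR_ge0.
pose d : R := Normc.normc (denom_inv q alpha a r * a r).
have d0 : 0 <= d by exact: normc_ge0.
rewrite -/d -/k (_ : (2 * A + c) * d * k = 2 * A * d * k + c * d * k); last by ring.
case: eqP => [a1|_].
  have h := ln_kernel_le _ _ s0 sr.
  rewrite (_ : Normc.normc _ = A * d * `|ln r - ln s|); last first.
    by rewrite -(mulrA _%:C) !Normc.normcM !normc_real /d a1 !Normc.normcM.
  apply: ler_wpDr; first exact: mulr_ge0 (mulr_ge0 c0 d0) k0.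
  apply: (@le_trans _ _ (A * d * (2 * k))).
    by rewrite ler_wpM2l ?mulr_ge0// /k a1.
  by rewrite le_eqVlt; apply/orP; left; apply/eqP; ring.
have h := powR_kernel_le _ _ s0 sr.
rewrite (_ : Normc.normc _ = c * d * `|r `^ (alpha - 1) - s `^ (alpha - 1)|); last first.
  rewrite [denom_inv _ _ _ _ * _]mulrC -(mulrA _%:C).
  by rewrite !Normc.normcM !normc_real /d !Normc.normcM.
apply: ler_wpDl; first exact: mulr_ge0 (mulr_ge0 (mulr_ge0 (ler0n _ 2) A0) d0) k0.
by rewrite ler_wpM2l// mulr_ge0.
Qed.

End KernelBound.

(** * The operator on bounded radial functions *)

Section VolterraOperator.
Context {R : realType} {K : fieldType} {abs : K -> R} {q : nat}.
Context {mu : {measure set (borelK abs) -> \bar R}} {alpha : R} (a : R -> R[i]).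
Hypothesis lf : nonarch_local_field abs q.
Hypothesis haar : normalized_haar abs mu.
Hypothesis alpha0 : 0 < alpha.
Local Notation Q := (q%:R : R).

Definition volterra_integrand (v : R -> R[i]) (r : R) (y : borelK abs) : R[i] :=
  radial_kernel q alpha a r (abs y) * v (abs y).

Definition volterra_integrable (v : R -> R[i]) (r : R) : Prop :=
  cintegrable abs mu [set y | abs y < r] (volterra_integrand v r).

Definition volterra (v : R -> R[i]) (r : R) : R[i] :=
  cintegral abs mu [set y | abs y < r] (volterra_integrand v r).

Lemma k_alphaE (x y : K) :
  k_alpha abs q alpha a x y = radial_kernel q alpha a (abs x) (abs y).
Proof. by rewrite /k_alpha /radial_kernel (abs_eq0E lf). Qed.

Lemma volterraB (v w : R -> R[i]) (x : K) :
  volterra_integrable v (abs x) -> volterra_integrable w (abs x) ->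
  volterra (fun s => v s - w s) (abs x) = volterra v (abs x) - volterra w (abs x).
Proof.
move=> [vr vi] [wr wi]; rewrite /volterra /cintegral.
have mD := measurable_open_ball lf x.
pose dif (p : R[i] -> R) (y : borelK abs) : R :=
  p (volterra_integrand v (abs x) y) - p (volterra_integrand w (abs x) y).
transitivity (Complex
  (Rintegral mu [set y | abs y < abs x] (dif (@complex.Re R)))
  (Rintegral mu [set y | abs y < abs x] (dif (@complex.Im R)))).
  by congr (Complex _ _); apply: eq_Rintegral => y _;
    rewrite /dif /volterra_integrand mulrBr ?ReB ?ImB.
by rewrite /dif !RintegralB.
Qed.

(** Integrating |y|^(e-1) over |y| < |x| gives a multiple of |x|^e, which combines with the kernel
    factor |x|^(alpha-e) into |x|^alpha. *)
Lemma volterra_bound :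
  exists2 C : R, 0 <= C & forall (x : K) (v : R -> R[i]) (B : R), 0 <= B ->
    (forall y, abs y < abs x -> Normc.normc (v (abs y)) <= B) ->
    volterra_integrable v (abs x) /\
    Normc.normc (volterra v (abs x)) <=
      C * Normc.normc (denom_inv q alpha a (abs x) * a (abs x)) * abs x `^ alpha * B.
Proof.
have [e [e0 ea eh]] : exists e : R, [/\ 0 < e, e <= alpha & e <= 2^-1].
  have [h|h] := leP alpha 2^-1; first by exists alpha.
  by exists 2^-1; rewrite invr_gt0 ltr0n ltW.
have [C C0 hC] := radial_kernel_bound e0 ea eh q a.
have Qe : 0 < 1 - Q `^ (- e) by rewrite subr_gt0 (powR_qN_lt1 lf).
(* The 2 accounts for the real and imaginary parts, estimated separately through [part]. *)
exists (2 * C / (1 - Q `^ (- e))).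
  by rewrite divr_ge0 ?mulr_ge0// ltW.
move=> x v B B0 vB.
set d := Normc.normc (denom_inv _ _ _ _ * _); have d0 : 0 <= d by exact: normc_ge0.
set D := [set y | abs y < abs x].
pose c := C * d * abs x `^ (alpha - e) * B.
have c0 : 0 <= c by rewrite !mulr_ge0// powR_ge0.
have hb y : y != 0 -> abs y < abs x ->
    Normc.normc (volterra_integrand v (abs x) y) <= c * abs y `^ (e - 1).
  move=> y0 yx; rewrite Normc.normcM; have yp := abs_gt0 lf _ y0.
  apply: le_trans (ler_pM (normc_ge0 _) (normc_ge0 _) (hC _ _ yp yx) (vB _ yx)) _.
  by rewrite -/d /c le_eqVlt; apply/orP; left; apply/eqP; ring.
have part (p : R[i] -> R) : (forall z, `|p z| <= Normc.normc z) ->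
    mu.-integrable D (fun y => (p (volterra_integrand v (abs x) y))%:E) /\
    `|Rintegral mu D (fun y => p (volterra_integrand v (abs x) y))|
      <= c * (abs x) `^ e / (1 - Q `^ (- e)).
  move=> pz.
  apply: (radial_integral lf haar
    (fun s => p (radial_kernel q alpha a (abs x) s * v s))) => // y y0 yx.
  by apply: le_trans (pz _) _; exact: hb.
have [rI rB] := part _ (@Re_le_normc R).
have [iI iB] := part _ (@Im_le_normc R).
split; first by split.
apply: le_trans (normc_le_add _ _) _; apply: le_trans (lerD rB iB) _.
rewrite /c (_ : abs x `^ alpha = abs x `^ (alpha - e) * abs x `^ e); last first.
  by rewrite -powRD subrK// gt_eqF.
lra.
Qed.

End VolterraOperator.

(** * Behaviour near the origin *)

Section GeometricLimit.
Context {R : realType}.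

Lemma half_pow_small (B e : R) : 0 < e -> exists m : nat, B / 2 ^+ m < e.
Proof.
move=> e0.
have h2 : `|2^-1 : R| < 1 by rewrite ger0_norm ?invr_ge0// invf_lt1 ?ltr1n.
have /cvgrPdist_lt/(_ e e0)[k _ /(_ k (leqnn k))] := @cvg_geometric R B _ h2.
rewrite /= sub0r normrN exprVn => h; exists k.
exact: le_lt_trans (ler_norm _) h.
Qed.

Lemma half_pow_le0 (x B : R) : (forall m : nat, x <= B / 2 ^+ m) -> x <= 0.
Proof.
move=> h; rewrite leNgt; apply/negP => /(half_pow_small B)[m].
by rewrite ltNge h.
Qed.

(** With [t m] the sum of B / 2^k over k >= m, [u - t] is nondecreasing and [u + t] nonincreasing.
    Every value of the former lies below every value of the latter, so the supremum of [u - t] is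
    within [t m] of each [u m]. *)
Lemma real_geometric_limit (u : nat -> R) (B : R) :
  (forall m, `|u m.+1 - u m| <= B / 2 ^+ m) ->
  exists l, forall m, `|l - u m| <= 2 * B / 2 ^+ m.
Proof.
move=> h; pose t m := 2 * B / 2 ^+ m.
have tS m : t m.+1 = t m - B / 2 ^+ m.
  by rewrite /t exprS invfM; field; rewrite expf_neq0.
have B0 : 0 <= B by have := le_trans (normr_ge0 _) (h 0%N); rewrite expr0 divr1.
have lo m n : (m <= n)%N -> u m - t m <= u n - t n.
  move=> /subnK <-; elim: (n - m)%N => [//|k IH]; rewrite addSn.
  by have := h (k + m)%N; rewrite tS ler_norml; lra.
have hi m n : (m <= n)%N -> u n + t n <= u m + t m.
  move=> /subnK <-; elim: (n - m)%N => [//|k IH]; rewrite addSn.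
  by have := h (k + m)%N; rewrite tS ler_norml; lra.
have t0 m : 0 <= t m by rewrite divr_ge0 ?mulr_ge0 ?exprn_ge0.
have mid m n : u m - t m <= u n + t n.
  have := t0 (maxn m n).
  by have := lo _ _ (leq_maxl m n); have := hi _ _ (leq_maxr m n); lra.
pose A := [set u m - t m | m in [set: nat]].
have supA : has_sup A.
  split; first by exists (u 0%N - t 0%N), 0%N.
  by exists (u 0%N + t 0%N) => _ [m _ <-].
exists (sup A) => m.
have h1 : u m - t m <= sup A by apply: ub_le_sup; [case: supA|exists m].
have h2 : sup A <= u m + t m by apply: ge_sup; [case: supA|move=> _ [k _ <-]].
by rewrite -/(t m) ler_norml; lra.
Qed.

Lemma complex_geometric_limit (u : nat -> R[i]) (B : R) :
  (forall m, Normc.normc (u m.+1 - u m) <= B / 2 ^+ m) ->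
  exists l, forall m, Normc.normc (l - u m) <= 4 * B / 2 ^+ m.
Proof.
move=> h.
have [x hx] : exists l, forall m, `|l - complex.Re (u m)| <= 2 * B / 2 ^+ m.
  by apply: real_geometric_limit => m; rewrite -ReB; exact: le_trans (Re_le_normc _) (h m).
have [y hy] : exists l, forall m, `|l - complex.Im (u m)| <= 2 * B / 2 ^+ m.
  by apply: real_geometric_limit => m; rewrite -ImB; exact: le_trans (Im_le_normc _) (h m).
exists (x +i* y) => m; have := hx m; have := hy m; case: (u m) => a b /= h1 h2.
apply: le_trans (normc_le_add _ _) _.
by move: h1 h2; rewrite -!mulrA; lra.
Qed.

End GeometricLimit.

(** * Continuity estimates at the origin *)

Section NearZero.
Context {R : realType} {K : fieldType} {abs : K -> R} {q : nat}.
Context {alpha : R} {a f : R -> R[i]}.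
Hypothesis lf : nonarch_local_field abs q.
Hypothesis alpha0 : 0 < alpha.
Hypothesis ca : radial_continuous_on abs a setT.
Hypothesis cf : radial_continuous_on abs f setT.
Local Notation Q := (q%:R : R).
Local Notation normc := (@Normc.normc R).

Lemma powR_near0 (e : R) : 0 < e ->
  exists M : int, forall x : K, abs x <= Q ^ M -> abs x `^ alpha <= e.
Proof.
move=> e0; have [M hM] := qX_small lf _ (powR_gt0 alpha^-1 e0).
exists M => x xM.
have -> : e = (e `^ alpha^-1) `^ alpha.
  by rewrite -powRrM mulVf ?gt_eqF// powRr1// ltW.
apply: ge0_ler_powR; rewrite ?nnegrE ?powR_ge0 ?(abs_ge0 lf) ?ltW//.
exact: le_lt_trans xM hM.
Qed.

Lemma radial_bounded_near0 (g : R -> R[i]) (S : set K) : S 0 ->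
  radial_continuous_on abs g S ->
  exists M : int, forall x, S x -> abs x <= Q ^ M ->
    normc (g (abs x)) <= normc (g 0) + 1.
Proof.
move=> S0 /(radial_continuous_onP lf _ _ S0)/(_ 1 ltr01)[M hM].
exists M => x Sx xM; rewrite -[g (abs x)](subrK (g 0)).
apply: le_trans (normcD_le _ _) _.
by rewrite addrC lerD2l ltW// hM.
Qed.

Lemma denom_near0 (e : R) : 0 < e -> exists M : int, forall x : K,
  abs x <= Q ^ M -> normc (denom_inv q alpha a (abs x) - 1) <= e.
Proof.
move=> e0; have [Ma hMa] := radial_bounded_near0 _ _ I ca.
pose c := Q `^ (- alpha) * (normc (a 0) + 1).
have a1 : 0 < normc (a 0) + 1 by rewrite ltr_wpDl ?normc_ge0.
have c0 : 0 < c by rewrite mulr_gt0 ?powR_gt0 ?(q_gt0 lf).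
(* If |z| <= e' then |z| / |1 + z| <= e' / (1 - e') <= 2 e' <= e, since e' <= 1/2; the cap at 1 also
   keeps 1 + z away from 0. *)
pose e' := Num.min e 1 / 2.
have e'0 : 0 < e' by rewrite divr_gt0// lt_min e0 ltr01.
have e'e : 2 * e' <= e by rewrite /e' mulrCA mulfV// mulr1 ge_min lexx.
have e'1 : 2 * e' <= 1 by rewrite /e' mulrCA mulfV// mulr1 ge_min lexx orbT.
have [Mp hMp] := powR_near0 _ (divr_gt0 e'0 c0).
exists (Num.min Ma Mp) => x xM.
have [xa xp] : abs x <= Q ^ Ma /\ abs x <= Q ^ Mp.
  by split; apply: le_trans xM _; rewrite ler_eXz2l ?(q_gt1 lf)// ge_min lexx ?orbT.
rewrite /denom_inv.
set z : R[i] := _ * _%:C.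
have hz : normc z <= e'.
  rewrite /z !Normc.normcM !normc_real !ger0_norm ?powR_ge0//.
  have := hMp _ xp; rewrite ler_pdivlMr// mulrC; apply: le_trans.
  rewrite ler_wpM2r ?powR_ge0// /c ler_wpM2l ?powR_ge0//.
  exact: hMa.
have h1 : 1 - e' <= normc (1 + z).
  rewrite lerBlDr; apply: (@le_trans _ _ (normc (1 + z) + normc z)).
    by rewrite -[leLHS](@Normc.normc1 R) -[X in normc X <= _](addrK z) normcB_le.
  by rewrite lerD2l.
have z1 : 1 + z != 0.
  by apply/eqP => z0; move: h1; rewrite z0 Normc.normc0; move: e'0 e'1; lra.
have -> : (1 + z)^-1 - 1 = - z * (1 + z)^-1.
  by apply: (mulIf z1); rewrite mulrBl -mulrA mulVf// mulr1 mul1r opprD addrA subrr sub0r.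
rewrite Normc.normcM normcN Normc.normcV ler_pdivrMr; last first.
  by move: h1 e'0 e'1; lra.
have := normc_ge0 z; move: h1 hz e'0 e'e e'1.
move: (normc z) (normc (1 + z)) => s t; nra.
Qed.

Lemma denom_inv0 : denom_inv q alpha a 0 = 1.
Proof. by rewrite /denom_inv powR0 ?gt_eqF// mulr0 addr0 invr1. Qed.

Lemma F_near0 (e : R) : 0 < e -> exists M : int, forall x : K,
  abs x <= Q ^ M -> normc (F_rhs q alpha a f (abs x) - F_rhs q alpha a f 0) <= e.
Proof.
move=> e0; have [Mf hMf] := radial_bounded_near0 _ _ I cf.
have e2 : 0 < e / 2 by rewrite divr_gt0.
have /(_ _ e2)[Mc hMc] := (radial_continuous_onP lf _ _ I).1 cf.
have f1 : 0 < normc (f 0) + 1 by rewrite ltr_wpDl ?normc_ge0.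
have [Md hMd] := denom_near0 _ (divr_gt0 e2 f1).
exists (Num.min Mf (Num.min Mc Md)) => x xM.
have [xf xc xd] : [/\ abs x <= Q ^ Mf, abs x <= Q ^ Mc & abs x <= Q ^ Md].
  by split; apply: le_trans xM _; rewrite ler_eXz2l ?(q_gt1 lf)// !ge_min lexx ?orbT.
rewrite /F_rhs denom_inv0 mul1r.
set d := denom_inv _ _ _ _.
have -> : d * f (abs x) - f 0 = (d - 1) * f (abs x) + (f (abs x) - f 0).
  by rewrite mulrBl mul1r addrA subrK.
apply: le_trans (normcD_le _ _) _; rewrite (splitr e) lerD//; last exact/ltW/hMc.
rewrite Normc.normcM.
apply: le_trans (ler_pM (normc_ge0 _) (normc_ge0 _) (hMd _ xd) (hMf _ I xf)) _.
by rewrite divfK// gt_eqF.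
Qed.

End NearZero.

(** * Existence and uniqueness *)

Section FixedPoint.
Context {R : realType} {K : fieldType} {abs : K -> R} {q : nat}.
Context {mu : {measure set (borelK abs) -> \bar R}}.
Context {alpha : R} {a f : R -> R[i]}.
Hypothesis lf : nonarch_local_field abs q.
Hypothesis haar : normalized_haar abs mu.
Hypothesis alpha0 : 0 < alpha.
Hypothesis ca : radial_continuous_on abs a setT.
Hypothesis cf : radial_continuous_on abs f setT.
Local Notation Q := (q%:R : R).
Local Notation normc := (@Normc.normc R).
Local Notation T := (@volterra R K abs q mu alpha a).
Local Notation integrable_at := (@volterra_integrable R K abs q mu alpha a).
Local Notation F := (F_rhs q alpha a f).
Local Notation solution := (is_solution abs q mu alpha a f).

Lemma ballN0 (N : int) : ballN abs q N 0.
Proof. by rewrite /ballN /= (abs0 lf) ltW ?(qX_gt0 lf). Qed.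

Lemma ballN_le (M N : int) (x : K) : M <= N -> ballN abs q M x -> ballN abs q N x.
Proof. by move=> MN xM; apply: le_trans xM _; rewrite ler_eXz2l ?(q_gt1 lf). Qed.

Lemma ballN_lt (N : int) (x y : K) : ballN abs q N x -> abs y < abs x -> ballN abs q N y.
Proof. by move=> xN yx; exact: le_trans (ltW yx) xN. Qed.

Lemma is_solutionE (N : int) (v : R -> R[i]) :
  solution N v <->
  radial_continuous_on abs v (ballN abs q N) /\
  forall x, ballN abs q N x ->
    integrable_at v (abs x) /\ v (abs x) + T v (abs x) = F (abs x).
Proof.
have E x : (fun y : borelK abs => k_alpha abs q alpha a x y * v (abs y)) =
    volterra_integrand (abs := abs) (q := q) (alpha := alpha) a v (abs x).
  by apply/funext => y; rewrite (k_alphaE a lf).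
by split=> -[cv h]; split=> // x /h; rewrite E.
Qed.

(** In [volterra_bound] the factor |x|^alpha tends to 0 while the coefficient stays bounded near the
    origin, so the operator norm on small balls is arbitrarily small. *)
Lemma volterra_small (e : R) : 0 < e -> exists M : int, forall x v B,
  ballN abs q M x -> 0 <= B -> (forall y, abs y < abs x -> normc (v (abs y)) <= B) ->
  normc (T v (abs x)) <= e * B.
Proof.
move=> e0; have [C C0 hC] := @volterra_bound R K abs q mu alpha a lf haar alpha0.
have [Ma hMa] := radial_bounded_near0 lf _ _ I ca.
have [Md hMd] := denom_near0 lf alpha0 ca _ ltr01.
(* The 2 bounds [denom_inv], which is within 1 of 1 here; the other factor bounds [a]. *)
pose A := 2 * (normc (a 0) + 1).
have A0 : 0 < A by rewrite mulr_gt0// ltr_wpDl ?normc_ge0.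
have D0 : 0 < C * A + 1 by rewrite ltr_wpDl// mulr_ge0// ltW.
have [Mp hMp] := powR_near0 lf alpha0 _ (divr_gt0 e0 D0).
exists (Num.min Ma (Num.min Md Mp)) => x v B xM B0 vB.
have [xa xd xp] : [/\ abs x <= Q ^ Ma, abs x <= Q ^ Md & abs x <= Q ^ Mp].
  by split; apply: (ballN_le _ _ _ _ xM); rewrite !ge_min lexx ?orbT.
apply: le_trans (hC _ _ _ B0 vB).2 _; rewrite ler_wpM2r//.
have hd : normc (denom_inv q alpha a (abs x) * a (abs x)) <= A.
  rewrite Normc.normcM ler_pM ?normc_ge0 ?hMa//.
  rewrite -[denom_inv _ _ _ _](subrK 1); apply: le_trans (normcD_le _ _) _.
  by rewrite Normc.normc1 -[2]/(1 + 1) lerD2r hMd.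
have hp := hMp _ xp; rewrite ler_pdivlMr// in hp.
apply: (@le_trans _ _ (C * A * abs x `^ alpha)).
  by rewrite ler_wpM2r ?powR_ge0// ler_wpM2l.
apply: le_trans hp; rewrite mulrC ler_wpM2l ?powR_ge0//.
by rewrite lerDl.
Qed.

Lemma volterra_eq0 (x : K) (v : R -> R[i]) :
  (forall y, abs y < abs x -> v (abs y) = 0) -> T v (abs x) = 0.
Proof.
move=> v0; have [C _ hC] := @volterra_bound R K abs q mu alpha a lf haar alpha0.
apply/Normc.eq0_normc/le_anti; rewrite normc_ge0 andbT.
have [|_] := hC x v 0 (lexx 0); last by rewrite mulr0.
by move=> y /v0 ->; rewrite Normc.normc0.
Qed.

Lemma volterra_at0 (v : R -> R[i]) : T v 0 = 0.
Proof.
rewrite -(abs0 lf); apply: volterra_eq0 => y.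
by rewrite (abs0 lf) ltNge (abs_ge0 lf).
Qed.

Lemma bounded_integrable (x : K) (v : R -> R[i]) (B : R) :
  (forall y, abs y < abs x -> normc (v (abs y)) <= B) -> integrable_at v (abs x).
Proof.
move=> vB; have [C _ hC] := @volterra_bound R K abs q mu alpha a lf haar alpha0.
(* At x = 0 the hypothesis is vacuous and [B] may be negative, hence the maximum. *)
apply: (hC x v (Num.max B 0) _ _).1; first by rewrite le_max lexx orbT.
by move=> y /vB vy; rewrite le_max vy.
Qed.

(** Since T v vanishes at 0, v(0) = F(0) and v - v(0) = (F - F(0)) - T v, where both terms are small
    near the origin. The separate radius q^M lets a bound on a smaller ball serve after an
    extension. *)
Lemma bounded_solution_continuous (N M : int) (v : R -> R[i]) (B : R) :
  (forall x, ballN abs q M x -> normc (v (abs x)) <= B) ->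
  (forall x, ballN abs q N x -> v (abs x) + T v (abs x) = F (abs x)) ->
  radial_continuous_on abs v (ballN abs q N).
Proof.
move=> vB veq; apply/(radial_continuous_onP lf _ _ (ballN0 N)) => e e0.
have B0 : 0 <= B by exact: le_trans (normc_ge0 _) (vB 0 (ballN0 M)).
have e2 : 0 < e / 2 by rewrite divr_gt0.
have B1 : 0 < B + 1 by rewrite ltr_wpDl.
(* [F_near0] gives a weak inequality; asking for a quarter of [e] makes the final estimate
   strict. *)
have [MF hMF] := F_near0 lf alpha0 ca cf _ (divr_gt0 e2 (ltr0n _ 2)).
have [MT hMT] := volterra_small _ (divr_gt0 e2 B1).
exists (Num.min M (Num.min MF MT)) => y yN yM.
have [y1 y2 y3] : [/\ ballN abs q M y, ballN abs q MF y & ballN abs q MT y].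
  by split; apply: ballN_le yM; rewrite !ge_min lexx ?orbT.
have v0 : v 0 = F 0.
  by have := veq 0 (ballN0 N); rewrite (abs0 lf) volterra_at0 addr0.
have vy : v (abs y) = F (abs y) - T v (abs y) by rewrite -(veq y yN) addrK.
rewrite vy v0 addrAC; apply: le_lt_trans (normcB_le _ _) _.
have h1 := hMF y y2.
have h2 : normc (T v (abs y)) <= e / 2 / (B + 1) * B.
  by apply: hMT => // z zy; apply: vB; exact: ballN_lt y1 zy.
have h3 : e / 2 / (B + 1) * B <= e / 2.
  by rewrite -mulrA ler_piMr ?(ltW e2)// mulrC ler_pdivrMr// mul1r lerDl.
have h4 : e / 2 / 2 < e / 2 by rewrite ltr_pdivrMr// mulr2n mulrDr mulr1 ltrDl.
rewrite (splitr e); apply: ltr_leD; first exact: le_lt_trans h1 h4.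
exact: le_trans h2 h3.
Qed.

(* [T] has norm at most 1/2 on small balls, and the Picard iterates converge
   geometrically there. *)
Lemma local_solution : exists M : int, forall N : int, N <= M ->
  exists v, solution N v /\ exists B, forall x, ballN abs q N x -> normc (v (abs x)) <= B.
Proof.
have h0 : 0 < 2^-1 :> R by rewrite invr_gt0.
have [MT hMT] := volterra_small _ h0.
have [MF hMF] := F_near0 lf alpha0 ca cf _ ltr01.
exists (Num.min MT MF) => N NM.
have NT x : ballN abs q N x -> ballN abs q MT x.
  by apply: ballN_le; apply: le_trans NM _; rewrite ge_min lexx.
pose B := normc (F 0) + 1.
have B0 : 0 <= B by rewrite addr_ge0 ?normc_ge0.
have FB x : ballN abs q N x -> normc (F (abs x)) <= B.
  move=> xN; rewrite -[F _](subrK (F 0)); apply: le_trans (normcD_le _ _) _.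
  rewrite addrC lerD2l; apply: hMF; apply: ballN_le xN.
  by apply: le_trans NM _; rewrite ge_min lexx orbT.
pose u := fix u (m : nat) : R -> R[i] :=
  if m is m'.+1 then fun r => F r - T (u m') r else fun=> 0.
have u0 r : u 0%N r = 0 by [].
have uE m r : u m.+1 r = F r - T (u m) r by [].
(* The bound 2 B reproduces itself: B from F plus half of 2 B from T. *)
have uB m x : ballN abs q N x -> normc (u m (abs x)) <= 2 * B.
  elim: m x => [|m IH] x xN; first by rewrite u0 Normc.normc0 mulr_ge0.
  rewrite uE; apply: le_trans (normcB_le _ _) _; rewrite mulrDl mul1r lerD ?FB//.
  rewrite -[leRHS]mul1r -(mulVf (_ : 2 != 0 :> R))// -mulrA.
  apply: hMT; [exact: NT|by rewrite mulr_ge0|move=> y yx].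
  exact/IH/(ballN_lt _ _ _ xN yx).
have uI m x : ballN abs q N x -> integrable_at (u m) (abs x).
  move=> xN; apply: (@bounded_integrable _ _ (2 * B)) => y yx.
  exact/uB/(ballN_lt _ _ _ xN yx).
have uS m x : ballN abs q N x -> normc (u m.+1 (abs x) - u m (abs x)) <= B / 2 ^+ m.
  elim: m x => [|m IH] x xN.
    by rewrite uE u0 subr0 expr0 divr1 volterra_eq0 ?subr0 ?FB.
  have -> : u m.+2 (abs x) - u m.+1 (abs x) = - T (fun s => u m.+1 s - u m s) (abs x).
    rewrite (volterraB _ lf _ _ _ (uI m.+1 x xN) (uI m x xN)).
    by rewrite !uE; ring.
  rewrite normcN exprS invfM mulrCA; apply: hMT; first exact: NT.
    by rewrite divr_ge0 ?exprn_ge0.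
  by move=> y yx; exact/IH/(ballN_lt _ _ _ xN yx).
(* The limit is chosen per radius, so that [v] is a function of |x|; radii not attained in the ball
   get the default 0. *)
have /choice[v hv] : forall r, exists l, (exists2 x, ballN abs q N x & r = abs x) ->
    forall m, normc (l - u m r) <= 4 * B / 2 ^+ m.
  move=> r; have [[x xN ->]|nr] := pselect (exists2 x, ballN abs q N x & r = abs x).
    by have [l hl] := complex_geometric_limit _ _ (fun m => uS m x xN); exists l.
  by exists 0 => /nr.
have vu x m : ballN abs q N x -> normc (v (abs x) - u m (abs x)) <= 4 * B / 2 ^+ m.
  by move=> xN; apply: hv; exists x.
have vB x : ballN abs q N x -> normc (v (abs x)) <= 4 * B.
  by move=> /(vu x 0%N); rewrite u0 subr0 expr0 divr1.
have vI x : ballN abs q N x -> integrable_at v (abs x).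
  move=> xN; apply: (@bounded_integrable _ _ (4 * B)) => y yx.
  exact/vB/(ballN_lt _ _ _ xN yx).
have veq x : ballN abs q N x -> v (abs x) + T v (abs x) = F (abs x).
  move=> xN; apply/eqP; rewrite -subr_eq0; apply/eqP/Normc.eq0_normc/le_anti.
  rewrite normc_ge0 andbT; apply: (@half_pow_le0 _ _ (4 * B)) => m.
  (* The residual is expressed through the errors of two consecutive iterates; each term is at most
     half of 4 B / 2^m. *)
  have -> : v (abs x) + T v (abs x) - F (abs x) =
      (v (abs x) - u m.+1 (abs x)) + T (fun s => v s - u m s) (abs x).
    rewrite (volterraB _ lf _ _ _ (vI x xN) (uI m x xN)).
    by rewrite uE; ring.
  have B4 : 0 <= 4 * B / 2 ^+ m by rewrite divr_ge0 ?mulr_ge0 ?exprn_ge0.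
  have hT : normc (T (fun s => v s - u m s) (abs x)) <= 2^-1 * (4 * B / 2 ^+ m).
    apply: hMT => [||y yx]; [exact: NT|exact: B4|].
    exact/vu/(ballN_lt _ _ _ xN yx).
  apply: le_trans (normcD_le _ _) _.
  have := vu x m.+1 xN; rewrite exprS invfM mulrCA.
  by move: hT; lra.
exists v; split; last by exists (4 * B).
apply/is_solutionE; split; first exact: (bounded_solution_continuous _ _ _ _ vB veq).
by move=> x xN; split; [exact: vI|exact: veq].
Qed.

(** For x on the new sphere the integral only sees the old ball, so the equation itself defines the
    value there. *)
Lemma extend_solution (N : int) (v : R -> R[i]) (B : R) :
  solution N v -> (forall x, ballN abs q N x -> normc (v (abs x)) <= B) ->
  exists w, solution (N + 1) w /\
    exists B', forall x, ballN abs q (N + 1) x -> normc (w (abs x)) <= B'.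
Proof.
move=> /is_solutionE[_ hv] vB.
pose w r := if r <= Q ^ N then v r else F r - T v r.
have wv x : ballN abs q N x -> w (abs x) = v (abs x) by rewrite /w /ballN /= => ->.
have lowN x y : ballN abs q (N + 1) x -> abs y < abs x -> ballN abs q N y.
  move=> xN yx; rewrite /ballN /= -[N](addrK 1) -(abs_lt_qX lf).
  exact: lt_le_trans yx xN.
have wI x : ballN abs q (N + 1) x -> integrable_at w (abs x).
  move=> xN; apply: (@bounded_integrable _ _ B) => y yx.
  by rewrite wv ?vB//; exact: lowN yx.
have vI x : ballN abs q (N + 1) x -> integrable_at v (abs x).
  by move=> xN; apply: (@bounded_integrable _ _ B) => y yx; apply: vB; exact: lowN yx.
have Tw x : ballN abs q (N + 1) x -> T w (abs x) = T v (abs x).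
  move=> xN; apply/eqP; rewrite -subr_eq0 -(volterraB _ lf _ _ _ (wI x xN) (vI x xN)).
  by apply/eqP/volterra_eq0 => y yx; rewrite wv ?subrr//; exact: lowN yx.
have weq x : ballN abs q (N + 1) x -> w (abs x) + T w (abs x) = F (abs x).
  move=> xN; rewrite Tw// /w; case: ifPn => [h|_]; first exact: (hv x h).2.
  by rewrite subrK.
exists w; split.
  apply/is_solutionE; split; last by move=> x xN; split; [exact: wI|exact: weq].
  by apply: (@bounded_solution_continuous _ N _ B) => // x xN; rewrite wv ?vB.
(* Only one sphere is added, so a single new value enters the bound. *)
exists (Num.max B (normc (w (Q ^ (N + 1))))) => x xN.
rewrite le_max; have [h|h] := boolP (abs x <= Q ^ N).
  by rewrite wv ?vB.
rewrite (_ : abs x = Q ^ (N + 1)) ?lexx ?orbT//.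
apply/le_anti/andP; split; first exact: xN.
by rewrite leNgt (abs_lt_qX lf) addrK.
Qed.

Lemma global_solution (N : int) : exists v, solution N v.
Proof.
have [M hM] := local_solution.
have [//|NM] := leP N M; first by move=> /hM[v [sv _]]; exists v.
(* The bound is part of the induction because [extend_solution] takes it as input. *)
suff [v [sv _]] : exists v, solution N v /\
    exists B, forall x, ballN abs q N x -> normc (v (abs x)) <= B by exists v.
have -> : N = M + (absz (N - M)%R)%:Z by lia.
elim: (absz _) => [|k [v [sv [B vB]]]]; first by rewrite addr0; exact: hM.
by rewrite -addn1 PoszD addrA; exact: extend_solution sv vB.
Qed.

(** The difference satisfies d = - T d. Near 0 it is bounded by continuity, and each use of this
    identity halves the bound, so d vanishes on a small ball and then on one sphere after
    another. *)
Lemma solution_unique (N : int) (v w : R -> R[i]) :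
  solution N v -> solution N w ->
  forall x, ballN abs q N x -> w (abs x) = v (abs x).
Proof.
move=> /is_solutionE[cv hv] /is_solutionE[cw hw].
pose d s := w s - v s.
have deq x : ballN abs q N x -> d (abs x) = - T d (abs x).
  move=> xN; have [[Iv ev] [Iw ew]] := (hv x xN, hw x xN).
  rewrite /d (volterraB _ lf _ _ _ Iw Iv).
  by rewrite -[w _](addrK (T w (abs x))) ew -ev; ring.
have h0 : 0 < 2^-1 :> R by rewrite invr_gt0.
have [MT hMT] := volterra_small _ h0.
have [Mv hMv] := radial_bounded_near0 lf _ _ (ballN0 N) cv.
have [Mw hMw] := radial_bounded_near0 lf _ _ (ballN0 N) cw.
pose M := Num.min N (Num.min MT (Num.min Mv Mw)).
have MP x : ballN abs q M x ->
    [/\ ballN abs q N x, ballN abs q MT x, ballN abs q Mv x & ballN abs q Mw x].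
  by move=> xM; split; apply: ballN_le xM; rewrite !ge_min lexx ?orbT.
pose B := (normc (w 0) + 1) + (normc (v 0) + 1).
have B0 : 0 <= B by rewrite !addr_ge0 ?normc_ge0.
have dB m x : ballN abs q M x -> normc (d (abs x)) <= B / 2 ^+ m.
  elim: m x => [|m IH] x xM; have [xN xT xv xw] := MP x xM.
    rewrite expr0 divr1; apply: le_trans (normcB_le _ _) _.
    by rewrite lerD ?hMv ?hMw.
  rewrite deq// normcN exprS invfM mulrCA; apply: hMT => //.
    by rewrite divr_ge0 ?exprn_ge0.
  by move=> y yx; exact/IH/(ballN_lt _ _ _ xM yx).
(* Here [k] counts the spheres beyond the small ball: if d vanishes for |y| < |x|, then T d, and
   hence d, vanishes at x. *)
have d0 (k : nat) x : ballN abs q N x -> ballN abs q (M + k%:Z) x -> d (abs x) = 0.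
  elim: k x => [|k IH] x xN.
    rewrite addr0 => xM; apply/Normc.eq0_normc/le_anti; rewrite normc_ge0 andbT.
    by apply: (@half_pow_le0 _ _ B) => m; exact: dB.
  rewrite -addn1 PoszD addrA => xM; rewrite deq// volterra_eq0 ?oppr0// => y yx.
  apply: IH; first exact: ballN_lt yx.
  rewrite /ballN /= -[M + k%:Z](addrK 1) -(abs_lt_qX lf).
  exact: lt_le_trans yx xM.
move=> x xN; apply/eqP; rewrite -subr_eq0; apply/eqP.
apply: (d0 (absz (N - M)%R)) => //; apply: ballN_le xN.
have : M <= N by rewrite /M ge_min lexx.
lia.
Qed.

End FixedPoint.
Theorem theorem1 (R : realType) (K : fieldType)
    (abs : K -> R) (q : nat) (mu : {measure set (borelK abs) -> \bar R})
    (alpha : R) (a f : R -> R[i]) (N : int) :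
  nonarch_local_field abs q ->
  normalized_haar abs mu ->
  0 < alpha ->
  radial_continuous_on abs a setT ->
  radial_continuous_on abs f setT ->
  (forall x : K, abs x <= (q%:R : R) ^ N ->
     Normc.normc (((q%:R : R) `^ (- alpha))%:C * a (abs x) * (abs x `^ alpha)%:C) < 1) ->
  exists v : R -> R[i],
    is_solution abs q mu alpha a f N v /\
    forall w : R -> R[i], is_solution abs q mu alpha a f N w ->
      forall x, ballN abs q N x -> w (abs x) = v (abs x).
Proof.
move=> lf haar alpha0 ca cf _.
have [v sv] := global_solution lf haar alpha0 ca cf N.
by exists v; split=> // w; exact: (solution_unique lf haar alpha0 ca _ _ _ sv).
Qed.
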